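(* Let $\mathcal{G}$ be a connected RCOP block graph. Then $\ker(\psi_{\mathcal{G}})=\ker(\varphi_{\mathcal{G}})$. In particular, if $f=f_1-f_2$ is a binomial in $\ker(\varphi_{\mathcal{G}})$, with $f_1=\prod_{m}\sigma_{i_mj_m}$ and $f_2=\prod_m\sigma_{k_ml_m}$, then the multiset of colors of all vertices lying on the shortest paths $i_m\leftrightarrow j_m$ equals the multiset of colors of all vertices lying on the shortest paths $k_m\leftrightarrow l_m$.
   Context: A colored graph $\mathcal{G}$ is a finite simple undirected graph on vertex set $[n]$ with a coloring $\lambda$ of its vertices and edges; $\Gamma(\mathcal{G})$ is the group of graph automorphisms preserving all vertex and edge colors. $\mathcal{G}$ is RCOP if the vertex colors and edge colors form disjoint sets, any two same-colored vertices are mapped to one another by some element of $\Gamma(\mathcal{G})$, and any two same-colored edges are mapped to one another by some element of $\Gamma(\mathcal{G})$. A graph on $[n]$ is a block graph if there is a vertex $c$ and a partition of $[n]$ into disjoint sets $A,B,\{c\}$ such that every path from $A$ to $B$ contains $c$, and the induced subgraphs on $A\cup\{c\}$ and $B\cup\{c\}$ are each complete graphs or block graphs. In a connected block graph any two vertices $i,j$ are joined by a unique shortest path $i\leftrightarrow j$, with vertex set $V(i\leftrightarrow j)$ and edge set $E(i\leftrightarrow j)$. The maps $\varphi_{\mathcal{G}},\psi_{\mathcal{G}}:\mathbb{R}[\sigma_{ij}: 1\le i\le j\le n]\to\mathbb{R}[t_\ell:\ell \text{ a color of }\mathcal{G}]$ are the monomial maps $\varphi_{\mathcal{G}}(\sigma_{ij})=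 t_{\lambda(i)}t_{\lambda(j)}\prod_{e\in E(i\leftrightarrow j)}t_{\lambda(e)}$ and $\psi_{\mathcal{G}}(\sigma_{ij})=\prod_{v\in V(i\leftrightarrow j)}t_{\lambda(v)}\prod_{e\in E(i\leftrightarrow j)}t_{\lambda(e)}$ (note for $i=j$, $\varphi_{\mathcal{G}}(\sigma_{ii})=t_{\lambda(i)}^2$). *)

(* Defs.v *)
From HB Require Import structures.
From mathcomp Require Import all_boot all_order all_fingroup all_algebra.
From mathcomp Require Import boolp classical_sets reals.
From mathcomp Require Import mpoly.

Set Implicit Arguments.
Unset Strict Implicit.
Unset Printing Implicit Defensive.

Import GRing.Theory.

(* Only the values of [ecol] on [edges] carry meaning. The palette [C] may
   contain colors that are not used by the graph. *)
Record colored_graph (n : nat) (C : finType) := ColoredGraph {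
  edges : {set {set 'I_n}};
  edges_card2 : forall e, e \in edges -> #|e| = 2;
  vcol : 'I_n -> C;
  ecol : {set 'I_n} -> C }.

Section ColoredGraph.
Variables (n : nat) (C : finType) (G : colored_graph n C).

Definition adj : rel 'I_n := fun i j => [set i; j] \in edges G.

Definition color_aut : {set {perm 'I_n}} :=
  [set s : {perm 'I_n} |
    [&& [forall e : {set 'I_n}, (s @: e \in edges G) == (e \in edges G)],
        [forall v, vcol G (s v) == vcol G v]
      & [forall e in edges G, ecol G (s @: e) == ecol G e]]].

Definition RCOP : Prop :=
  [/\ forall v e, e \in edges G -> vcol G v <> ecol G e,
      forall v w, vcol G v = vcol G w -> exists2 s, s \in color_aut & s v = w
    & forall e f, e \in edges G -> f \in edges G -> ecol G e = ecol G f ->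
        exists2 s : {perm 'I_n}, s \in color_aut & s @: e = f].

(* Paths are given by the list of all their vertices, end points included. *)
Definition is_path (i j : 'I_n) (p : seq 'I_n) : bool :=
  if p is x :: q then [&& uniq p, path adj x q, x == i & last x q == j]
  else false.

Definition is_shortest_path (i j : 'I_n) (p : seq 'I_n) : Prop :=
  is_path i j p /\ forall q, is_path i j q -> size p <= size q.

Definition connected_graph : Prop :=
  forall i j : 'I_n, exists p, is_path i j p.

Definition complete_on (S : {set 'I_n}) : Prop :=
  forall i j, i \in S -> j \in S -> i != j -> adj i j.

(* [block_on S]: the subgraph induced on [S] is a block graph. The parts [A]
   and [B] may be empty, so that nonempty complete graphs are block graphs. *)
Inductive block_on (S : {set 'I_n}) : Prop :=
  BlockOn (A B : {set 'I_n}) (c : 'I_n) of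
    S = A :|: B :|: [set c]
  & [disjoint A & B] & c \notin A & c \notin B
  & (forall a b p, a \in A -> b \in B -> is_path a b p -> {subset p <= S} ->
       c \in p)
  & complete_on (A :|: [set c]) \/ block_on (A :|: [set c])
  & complete_on (B :|: [set c]) \/ block_on (B :|: [set c]).

Definition block_graph : Prop := block_on [set: 'I_n].

(* In a connected block graph the shortest path exists and is unique, so the
   choice made by [xget] is forced. *)
Definition shortest_path (i j : 'I_n) : seq 'I_n :=
  xget [::] (mkset (is_shortest_path i j)).

Definition path_vertices (i j : 'I_n) : {set 'I_n} :=
  [set v in shortest_path i j].

Definition path_edges (i j : 'I_n) : {set {set 'I_n}} :=
  let p := shortest_path i j in
  [set [set x.1; x.2] | x in zip p (behead p)].

End ColoredGraph.

Definition index_pair (n : nat) := {p : 'I_n * 'I_n | p.1 <= p.2}.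

Local Open Scope ring_scope.

Section Maps.
Variable R : realType.

Definition sigma_ring (n : nat) := {mpoly R[#|{: index_pair n}|]}.
Definition color_ring (C : finType) := {mpoly R[#|C|]}.

Definition sigma (n : nat) (ij : index_pair n) : sigma_ring n :=
  'X_(enum_rank ij).
Definition tvar (C : finType) (l : C) : color_ring C := 'X_(enum_rank l).

Variables (n : nat) (C : finType) (G : colored_graph n C).

Definition phi_var (i j : 'I_n) : color_ring C :=
  tvar (vcol G i) * tvar (vcol G j) *
  \prod_(e in path_edges G i j) tvar (ecol G e).

Definition psi_var (i j : 'I_n) : color_ring C :=
  (\prod_(v in path_vertices G i j) tvar (vcol G v)) *
  \prod_(e in path_edges G i j) tvar (ecol G e).

Definition alg_map (F : 'I_n -> 'I_n -> color_ring C) :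
    sigma_ring n -> color_ring C :=
  mmap (@mpolyC #|C| R)
    (fun k => let ij := val (enum_val k : index_pair n) in F ij.1 ij.2).

Definition phi := alg_map phi_var.
Definition psi := alg_map psi_var.

End Maps.

Arguments sigma R {n} ij.
Arguments phi R {n C} G.
Arguments psi R {n C} G.

Definition poly_ker (U V : zmodType) (f : U -> V) : set U :=
  mkset (fun x => f x = 0).

Definition path_vertex_colors (n : nat) (C : finType) (G : colored_graph n C)
    (s : seq (index_pair n)) : seq C :=
  flatten [seq [seq vcol G v | v <- enum (path_vertices G (val ij).1 (val ij).2)]
          | ij <- s].

(* Main.v *)
Require Import Defs.
From HB Require Import structures.
From mathcomp Require Import all_boot all_order all_fingroup all_algebra.
From mathcomp Require Import boolp classical_sets reals.
From mathcomp Require Import mpoly zify.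

Set Implicit Arguments.
Unset Strict Implicit.
Unset Printing Implicit Defensive.

Import GRing.Theory.
Local Open Scope ring_scope.

(** Count the incidences between the edges of a path and the vertices of a fixed
    color [c] on it. Every vertex of the path meets two of its edges, up to a
    defect of one for each end point, while the number of end points of color
    [c] of an edge depends only on the color of that edge, because same-colored
    edges are exchanged by color-preserving automorphisms. Hence
      2 #(vertices of color c) = #(ends of color c) + sum_d m(c,d) #(edges of color d).
    Vertex and edge colors being disjoint, the edge counts can be read off both
    monomials, so two sigma-monomials have the same image under phi iff they
    have the same image under psi; the kernel of a monomial map is determined by
    its fibers on monomials. *)

(** * Kernels of monomial maps and their fibers on monomials *)

Section MonomialMaps.
Variables (R : comNzRingType) (n k : nat).

Lemma mmap_mpolyX (h : 'I_n -> 'X_{1..k}) (p : {mpoly R[n]}) :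
  mmap (@mpolyC k R) (fun i => 'X_[h i]) p =
  \sum_(m <- msupp p) p@_m *: 'X_[(\sum_(i < n) h i *+ m i)%MM].
Proof.
by apply: eq_bigr => m _; rewrite mul_mpolyC /mmap1 mprodXnE.
Qed.

(** The coefficient at [q] of the [Q]-sum adds up [p@_m] over the fiber of [Q] above [q]. That fiber
    is empty or is the fiber of [P] through any of its points [m0], where the [P]-sum has
    coefficient zero. *)
Lemma sum_mpolyX_eq0 (P Q : 'X_{1..n} -> 'X_{1..k}) (p : {mpoly R[n]}) :
    (forall m m', P m = P m' <-> Q m = Q m') ->
  \sum_(m <- msupp p) p@_m *: 'X_[P m] = 0 :> {mpoly R[k]} ->
  \sum_(m <- msupp p) p@_m *: 'X_[Q m] = 0 :> {mpoly R[k]}.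
Proof.
move=> PQ /mpolyP P0; apply/mpolyP => q; rewrite mcoeff0 raddf_sum /=.
have [/hasP[m0 _ /eqP <-]|/hasPn noq] := boolP (has (fun m => Q m == q) (msupp p)).
  rewrite -[RHS](mcoeff0 R (P m0)) -P0 raddf_sum /=.
  apply: eq_bigr => m _; rewrite !mcoeffZ !mcoeffX.
  suff -> : (Q m == Q m0) = (P m == P m0) by [].
  by apply/eqP/eqP => /PQ.
rewrite big_seq big1 // => m /noq /negPf Qm.
by rewrite mcoeffZ mcoeffX Qm mulr0.
Qed.

End MonomialMaps.

Local Open Scope nat_scope.

(** * Double counting of incidences along a simple path *)

Section PathIncidences.
Variable T : finType.

Definition seq_edges (p : seq T) : {set {set T}} :=
  [set [set x.1; x.2] | x in zip p (behead p)].

Lemma seq_edges_cons2 (x y : T) q :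
  seq_edges (x :: y :: q) = [set x; y] |: seq_edges (y :: q).
Proof.
apply/setP => e; rewrite !inE; apply/imsetP/idP => [[z]|].
  rewrite inE => /orP[/eqP-> ->|zq ->]; first by rewrite eqxx.
  by apply/orP; right; apply: imset_f.
case/orP => [/eqP->|/imsetP[z zq ->]]; last by exists z => //; rewrite inE zq orbT.
by exists (x, y) => //; rewrite inE eqxx.
Qed.

Lemma seq_edges_sub (p : seq T) e v : e \in seq_edges p -> v \in e -> v \in p.
Proof.
case: p => [|x p]; first by case/imsetP.
elim: p x => [|y p IH] x; first by case/imsetP.
rewrite seq_edges_cons2 => /setU1P[->|ep /(IH _ ep) vp]; last by rewrite inE vp orbT.
by rewrite !inE => /orP[]->; rewrite ?orbT.
Qed.

(** Prepending [x] to a path starting at [y] adds the edge [{x, y}], worth [f x + f y], and moves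
    the defect of the first end point from [y] to [x]. *)
Lemma sum_seq_edges (f : T -> nat) x (p : seq T) : uniq (x :: p) ->
  2 * (\sum_(v <- x :: p) f v) =
  f x + f (last x p) + \sum_(e in seq_edges (x :: p)) \sum_(v in e) f v.
Proof.
elim: p x => [|y p IH] x.
  rewrite big_seq1 (_ : seq_edges [:: x] = finset.set0) ?big_set0 /=; first by lia.
  by apply/setP => e; rewrite inE; apply/imsetP => -[].
(* Simplicity of the path is used twice: [{x, y}] is a new edge, since otherwise [x] would reappear
   later, and its two ends are distinct. *)
move=> /andP[xp up]; rewrite seq_edges_cons2 big_setU1 /=; last first.
  by apply: contra xp => /seq_edges_sub; apply; rewrite !inE eqxx.
have nxy : x != y by move: xp; rewrite inE negb_or => /andP[].
rewrite big_setU1 ?inE //= big_set1 big_cons mulnDr IH //.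
by move: (\sum_(e in seq_edges _) _) => S; lia.
Qed.

End PathIncidences.

(** * Color counts on shortest paths *)

Section ColoredGraphPaths.
Variables (n : nat) (C : finType) (G : colored_graph n C).

Lemma seq_edges_path x p : path (adj G) x p -> seq_edges (x :: p) \subset edges G.
Proof.
elim: p x => [|y p IH] x; first by move=> _; apply/fintype.subsetP => e /imsetP[].
case/andP=> xy py; rewrite seq_edges_cons2; apply/fintype.subsetP => e /setU1P[->//|].
by move: e; apply/fintype.subsetP/IH.
Qed.

Lemma shortest_pathP : connected_graph G ->
  forall i j, is_shortest_path G i j (shortest_path G i j).
Proof.
move=> conn i j; apply: xgetPex.
have ex_len : exists k, `[< exists2 p, is_path G i j p & size p = k >].
  by have [p pP] := conn i j; exists (size p); apply/asboolP; exists p.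
case: (ex_minnP ex_len) => _ /asboolP[p pP <-] pmin.
by exists p; split=> // q qP; apply: pmin; apply/asboolP; exists q.
Qed.

Definition edge_color (c : C) : bool := [exists e in edges G, ecol G e == c].

(** End points are counted with multiplicity, so [i = j] can give 2, as in the square that is the
    image of [sigma_ii] under [phi]. *)
Definition ends_count (i j : 'I_n) (c : C) : nat :=
  (vcol G i == c) + (vcol G j == c).

Definition vertex_count (i j : 'I_n) (c : C) : nat :=
  \sum_(v in path_vertices G i j) (vcol G v == c).

Definition edge_count (i j : 'I_n) (c : C) : nat :=
  \sum_(e in path_edges G i j) (ecol G e == c).

(* The number of end points of color [c] of an edge of color [d]; [0] when no
   edge has color [d]. *)
Definition incidence (c d : C) : nat :=
  \sum_(v in odflt finset.set0 [pick e in edges G | ecol G e == d]) (vcol G v == c).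

Hypothesis (conn : connected_graph G) (rcop : RCOP G).

Lemma incidence_ecol c e : e \in edges G ->
  incidence c (ecol G e) = \sum_(v in e) (vcol G v == c).
Proof.
move=> eE; rewrite /incidence; case: pickP => [f /andP[fE /eqP fe]|]; last first.
  by move/(_ e); rewrite eE eqxx.
(* The edge [f] picked by [incidence] may differ from [e], but a color automorphism [s] carries [f]
   onto [e], and reindexing along [s] keeps vertex colors. *)
case: rcop => _ _ /(_ _ _ fE eE fe)[s]; rewrite inE => /and3P[_ /forallP sc _] <-.
rewrite big_imset /=; last by move=> x y _ _; apply: perm_inj.
by apply: eq_bigr => v _; rewrite (eqP (sc v)).
Qed.

Lemma path_edges_sub i j : path_edges G i j \subset edges G.
Proof.
have [+ _] := shortest_pathP conn i j; rewrite /path_edges.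
by case: (shortest_path G i j) => // x p /and4P[_ /seq_edges_path].
Qed.

Lemma vertex_count_double i j c :
  2 * vertex_count i j c =
  ends_count i j c + \sum_d incidence c d * edge_count i j d.
Proof.
(* Group the edges of the path by color: after the exchange of sums, each [e] contributes only at
   [d = ecol G e]. *)
have -> : \sum_d incidence c d * edge_count i j d =
    \sum_(e in path_edges G i j) \sum_(v in e) (vcol G v == c).
  under eq_bigr do rewrite /edge_count big_distrr /=.
  rewrite exchange_big /=; apply: eq_bigr => e /(fintype.subsetP (path_edges_sub i j)) eE.
  rewrite -(incidence_ecol c eE) (bigD1 (ecol G e)) //= eqxx muln1 big1 ?addn0 //.
  by move=> d; rewrite eq_sym => /negPf->; rewrite muln0.
have [+ _] := shortest_pathP conn i j.
rewrite /vertex_count /path_vertices /path_edges.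
case: (shortest_path G i j) => // x p /and4P[up _ /eqP <- /eqP <-].
have := sum_seq_edges (fun v => vcol G v == c : nat) up.
move=> <-; congr (2 * _); rewrite big_uniq //.
by apply: eq_bigl => v; rewrite inE.
Qed.

Lemma vcol_not_edge_color v c : edge_color c -> (vcol G v == c) = false.
Proof.
case: rcop => disj _ _ /exists_inP[e eE /eqP <-].
by apply/eqP; apply: disj.
Qed.

Lemma ends_count0 i j c : edge_color c -> ends_count i j c = 0.
Proof. by move=> ec; rewrite /ends_count !vcol_not_edge_color. Qed.

Lemma vertex_count0 i j c : edge_color c -> vertex_count i j c = 0.
Proof. by move=> ec; apply: big1 => v _; rewrite vcol_not_edge_color. Qed.

Lemma edge_count0 i j c : ~~ edge_color c -> edge_count i j c = 0.
Proof.
move=> nec; apply: big1 => e /(fintype.subsetP (path_edges_sub i j)) eE.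
by apply/eqP; rewrite eqb0; apply: contra nec => ec; apply/exists_inP; exists e.
Qed.

(** * Exponents of the image of a whole monomial *)

Local Notation K := #|{: index_pair n}|.

(** If [F i j c] is the exponent of the variable of color [c] in the image of [sigma_ij], this is
    its exponent in the image of the monomial with exponents [m]. *)
Definition mnm_total (F : 'I_n -> 'I_n -> C -> nat) (m : 'X_{1..K}) (c : C) : nat :=
  \sum_(k < K) F (val (enum_val k)).1 (val (enum_val k)).2 c * m k.

Lemma mnm_total_add F F' m c :
  mnm_total (fun i j d => F i j d + F' i j d) m c = mnm_total F m c + mnm_total F' m c.
Proof. by rewrite -big_split /=; apply: eq_bigr => k _; rewrite mulnDl. Qed.

Lemma mnm_total0 F m c : (forall i j, F i j c = 0) -> mnm_total F m c = 0.
Proof. by move=> F0; apply: big1 => k _; rewrite F0. Qed.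

Lemma mnm_total_mnm1 F (s : seq (index_pair n)) c :
  mnm_total F (\sum_(ij <- s) U_(enum_rank ij))%MM c =
  \sum_(ij <- s) F (val ij).1 (val ij).2 c.
Proof.
rewrite /mnm_total; under [LHS]eq_bigr do rewrite mnm_sumE big_distrr /=.
rewrite exchange_big; apply: eq_bigr => ij _.
rewrite (bigD1 (enum_rank ij)) //= enum_rankK mnm1E eqxx muln1 big1 ?addn0 //.
by move=> k /negPf kij; rewrite mnm1E eq_sym kij muln0.
Qed.

Lemma mnm_total_vertex_double m c :
  2 * mnm_total vertex_count m c =
  mnm_total ends_count m c + \sum_d incidence c d * mnm_total edge_count m d.
Proof.
rewrite /mnm_total big_distrr /=.
under [X in _ = _ + X]eq_bigr do rewrite big_distrr /=.
rewrite exchange_big -big_split; apply: eq_bigr => k _ /=.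
rewrite mulnA vertex_count_double mulnDl big_distrl; congr (_ + _).
by apply: eq_bigr => d _; rewrite mulnA.
Qed.

(** At every color one of the two summands vanishes: [F] at edge colors, [edge_count] at all others.
    Their sum thus determines both. *)
Lemma mnm_total_split F m m' :
    (forall i j c, edge_color c -> F i j c = 0) ->
    mnm_total (fun i j c => F i j c + edge_count i j c) m =1
    mnm_total (fun i j c => F i j c + edge_count i j c) m' ->
  mnm_total F m =1 mnm_total F m' /\
  mnm_total edge_count m =1 mnm_total edge_count m'.
Proof.
move=> F0 eqm; suff H c : mnm_total F m c = mnm_total F m' c /\
    mnm_total edge_count m c = mnm_total edge_count m' c.
  by split=> c; case: (H c).
have := eqm c; rewrite !mnm_total_add.
have [ec|nec] := boolP (edge_color c).
  by rewrite !(@mnm_total0 F) // => *; apply: F0.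
by rewrite !(@mnm_total0 edge_count) ?addn0 // => *; apply: edge_count0.
Qed.

Definition phi_exp i j c := ends_count i j c + edge_count i j c.
Definition psi_exp i j c := vertex_count i j c + edge_count i j c.

Lemma phi_psi_exp_total m m' :
  mnm_total phi_exp m =1 mnm_total phi_exp m' <->
  mnm_total psi_exp m =1 mnm_total psi_exp m'.
Proof.
(* Equal edge counts cancel the incidence sums. The crossed form avoids subtraction in [nat] and
   serves both directions. *)
have half (eqE : mnm_total edge_count m =1 mnm_total edge_count m') c :
    2 * mnm_total vertex_count m c + mnm_total ends_count m' c =
    2 * mnm_total vertex_count m' c + mnm_total ends_count m c.
  rewrite !mnm_total_vertex_double; under eq_bigr do rewrite eqE.
  by rewrite addnAC [RHS]addnAC [X in X + _ = _]addnC.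
split=> [/(mnm_total_split ends_count0)|/(mnm_total_split vertex_count0)] [eqF eqE] c;
  rewrite /phi_exp /psi_exp !(mnm_total_add _ edge_count) eqE; congr (_ + _);
  by move: (half eqE c); rewrite eqF; lia.
Qed.

Lemma count_path_vertex_colors (s : seq (index_pair n)) c :
  count_mem c (path_vertex_colors G s) =
  \sum_(ij <- s) vertex_count (val ij).1 (val ij).2 c.
Proof.
rewrite count_flatten sumnE !big_map; apply: eq_bigr => ij _.
rewrite count_map /vertex_count -sum1_count big_mkcond /= big_enum /=.
by apply: eq_bigr => v _; case: (_ == c).
Qed.

End ColoredGraphPaths.

Local Open Scope ring_scope.

(** * Translation of the maps into exponent vectors *)

Section ExponentVectors.
Variables (R : realType) (n : nat) (C : finType) (G : colored_graph n C).

Definition mnm_of (f : C -> nat) : 'X_{1..#|C|} :=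
  [multinom f (enum_val k) | k < #|C|].

Lemma tvarE c : tvar R c = 'X_[mnm_of (fun d => c == d)].
Proof.
congr 'X_[_]; apply/mnmP => k; rewrite mnm1E mnmE; congr nat_of_bool.
by apply/eqP/eqP => [<-|->]; rewrite ?enum_rankK ?enum_valK.
Qed.

Lemma mnm_ofD f g : (mnm_of f + mnm_of g)%MM = mnm_of (fun c => (f c + g c)%N).
Proof. by apply/mnmP => k; rewrite mnmDE !mnmE. Qed.

Lemma prod_tvar (I : finType) (A : {set I}) (h : I -> C) :
  \prod_(x in A) tvar R (h x) = 'X_[mnm_of (fun d => (\sum_(x in A) (h x == d))%N)].
Proof.
under eq_bigr do rewrite tvarE.
rewrite mprodXE; congr 'X_[_]; apply/mnmP => k; rewrite mnm_sumE mnmE.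
by apply: eq_bigr => x _; rewrite mnmE.
Qed.

Lemma phi_varE i j : phi_var R G i j = 'X_[mnm_of (phi_exp G i j)].
Proof. by rewrite /phi_var prod_tvar !tvarE -!mpolyXD !mnm_ofD. Qed.

Lemma psi_varE i j : psi_var R G i j = 'X_[mnm_of (psi_exp G i j)].
Proof. by rewrite /psi_var !prod_tvar -!mpolyXD !mnm_ofD. Qed.

Lemma alg_map_mpolyX (F : 'I_n -> 'I_n -> color_ring R C) f p :
    (forall i j, F i j = 'X_[mnm_of (f i j)]) ->
  alg_map F p = \sum_(m <- msupp p) p@_m *: 'X_[mnm_of (mnm_total f m)].
Proof.
move=> FE; rewrite /alg_map.
under [X in mmap _ X]functional_extensionality_dep => k do rewrite FE.
rewrite mmap_mpolyX; apply: eq_bigr => m _; congr (_ *: 'X_[_]).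
apply/mnmP => c; rewrite mnm_sumE mnmE; apply: eq_bigr => k _.
by rewrite mulmnE mnmE.
Qed.

Lemma mnm_of_inj f g : mnm_of f = mnm_of g <-> f =1 g.
Proof.
split=> [/mnmP fg c|fg]; last by apply/mnmP => k; rewrite !mnmE fg.
by have := fg (enum_rank c); rewrite !mnmE enum_rankK.
Qed.

End ExponentVectors.

(** * From fibers on monomials to kernels and color multisets *)

Theorem theorem6p2 (R : realType) (n : nat) (C : finType)
    (G : colored_graph n C) (hconn : connected_graph G) (hRCOP : RCOP G)
    (hblock : block_graph G) :
  poly_ker (psi R G) = poly_ker (phi R G) /\
  (forall s1 s2 : seq (index_pair n),
     poly_ker (phi R G) (\prod_(ij <- s1) sigma R ij - \prod_(kl <- s2) sigma R kl) ->
     perm_eq (path_vertex_colors G s1) (path_vertex_colors G s2)).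
Proof.
have phiE p := alg_map_mpolyX p (phi_varE R G).
have psiE p := alg_map_mpolyX p (psi_varE R G).
have fibers m m' :
    mnm_of (mnm_total (phi_exp G) m) = mnm_of (mnm_total (phi_exp G) m') <->
    mnm_of (mnm_total (psi_exp G) m) = mnm_of (mnm_total (psi_exp G) m').
  by rewrite !mnm_of_inj; apply: phi_psi_exp_total.
split.
  apply/seteqP; split=> p; rewrite /poly_ker /= /phi /psi phiE psiE;
    apply: sum_mpolyX_eq0 => m m'; first by rewrite fibers.
  exact: fibers.
move=> s1 s2; rewrite /poly_ker /= /sigma !mprodXE /phi /alg_map mmapB.
have phiX m : alg_map (phi_var R G) 'X_[m] = 'X_[mnm_of (mnm_total (phi_exp G) m)].
  by rewrite phiE msuppX big_seq1 mcoeffX eqxx scale1r.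
move: (phiX (\sum_(ij <- s1) U_(enum_rank ij))%MM).
move: (phiX (\sum_(ij <- s2) U_(enum_rank ij))%MM).
rewrite /alg_map => -> -> /eqP; rewrite subr_eq0 => /eqP.
(* Compare coefficients at the image exponent of [s1]: it is 1 on one side, so the two image
   monomials coincide, as otherwise [1 = 0]. *)
move=> /mpolyP/(_ (mnm_of (mnm_total (phi_exp G) (\sum_(ij <- s1) U_(enum_rank ij))%MM))).
rewrite !mcoeffX eqxx; case: eqP => [/esym + _|_ /eqP]; last by rewrite oner_eq0.
(* Pass to the [psi] exponents, whose part away from the edge colors is exactly the count of path
   vertices by color. *)
move=> /fibers/mnm_of_inj/(mnm_total_split hconn (vertex_count0 hRCOP))[eqV _].
rewrite /perm_eq; apply/allP => c _ /=.
by rewrite !count_path_vertex_colors // -!mnm_total_mnm1 eqV.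
Qed.
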